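(* In an augmented virtual double category that has cocartesian tabulations (that is, every horizontal morphism admits a tabulation whose defining cell is cocartesian), all pointwise weak left Kan extensions are pointwise left Kan extensions. That is: any nullary cell that defines a vertical morphism $l$ as the pointwise weak left Kan extension of a vertical morphism $d$ along a path of horizontal morphisms $(J_1,\dotsc,J_n)$, $n\ge1$, also defines $l$ as the pointwise left Kan extension of $d$ along $(J_1,\dotsc,J_n)$.
   Context: **Augmented virtual double category** $\mathcal K$: it consists of objects; a category of vertical morphisms $f\colon A\to C$ between these objects; horizontal morphisms $J\colon A\nrightarrow B$ between objects; and cells. A cell $\phi\colon\underline J\Rightarrow\underline K$ has a horizontal source $\underline J=(J_1,\dotsc,J_n)$, a path $J_i\colon A_{i-1}\nrightarrow A_i$ of length $n\ge0$ (the empty path at $A_0$ is written $(A_0)$); a horizontal target $\underline K$, a path from $C$ to $D$ of length at most $1$ (so $\underline K=K\colon C\nrightarrow D$, or $\underline K=(C)$ with $C=D$, also written $\phi\colon\underline J\Rightarrow C$); a vertical source $f\colon A_0\to C$ and a vertical target $g\colon A_n\to D$. It is unary if $\underline K$ has length $1$, nullary if $\underline K$ has length $0$, vertical if $\underline J$ and $\underline K$ are both empty (written $\phi\colon f\Rightarrow g$), horizontal if $f$ and $g$ are identities. Given $n\ge1$ cells $\phi_i\colon\underline J_i\Rightarrow\underline K_i$, the vertical target of each being the vertical source of the next, and a cell $\psi\colon\underline K_1\frown\dotsb\frown\underline K_n\Rightarrow\underline L$ ($\frown$ denotes concatenation), there is a composite $\psi\circ(\phi_1,\dotsc,\phi_n)\colon\underline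 J_1\frown\dotsb\frown\underline J_n\Rightarrow\underline L$ whose vertical source (target) is that of $\psi$ composed with that of $\phi_1$ ($\phi_n$). There are identity cells $\mathrm{id}_J\colon J\Rightarrow J$ (horizontal) and $\mathrm{id}_f\colon f\Rightarrow f$ (vertical), with $\mathrm{id}_h\circ(\mathrm{id}_f)=\mathrm{id}_{h\circ f}$; $\mathrm{id}_A:=\mathrm{id}_{\mathrm{id}_A}$. Axioms: $\chi\circ(\psi_1\circ(\phi_{11},\dotsc,\phi_{1m_1}),\dotsc,\psi_n\circ(\phi_{n1},\dotsc,\phi_{nm_n}))=(\chi\circ(\psi_1,\dotsc,\psi_n))\circ(\phi_{11},\dotsc,\phi_{nm_n})$ whenever the left-hand side makes sense; $\mathrm{id}_C\circ(\phi)=\phi$, $\mathrm{id}_K\circ(\phi)=\phi$, $\phi\circ(\mathrm{id}_A)=\phi$, $\phi\circ(\mathrm{id}_{J_1},\dotsc,\mathrm{id}_{J_n})=\phi$ and $\psi\circ(\phi_1,\dotsc,\phi_i,\mathrm{id}_{f_i},\phi_{i+1},\dotsc,\phi_n)=\psi\circ(\phi_1,\dotsc,\phi_n)$ whenever these make sense. Notation: $h\circ\phi:=\mathrm{id}_h\circ(\phi)$, $\psi\circ f:=\psi\circ(\mathrm{id}_f)$; for adjacent cells $\phi\colon\underline J\Rightarrow\underline K$, $\psi\colon\underline H\Rightarrow\underline L$ with $\underline K\frown\underline L$ of length $\le1$, $\phi\odot\psi:=\mathrm{id}_{\underline K\frown\underline L}\circ(\phi,\psi)$, where $\mathrm{id}_{(C)}$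 means $\mathrm{id}_C$. **Cartesian cells and restrictions.** A cell $\psi\colon\underline J\Rightarrow\underline K$ with $\underline J$ of length $\le1$, vertical source $f$ and target $g$, is cartesian if every cell $\chi\colon\underline H\Rightarrow\underline K$ with vertical source $f\circ h$ and target $g\circ k$ factors uniquely as $\chi=\psi\circ\phi$ with $\phi\colon\underline H\Rightarrow\underline J$ having vertical source $h$ and target $k$. If $\underline J=J$ has length $1$ then $J$ is the restriction of $\underline K$ along $f$ and $g$, written $\underline K(f,g)$. **Cocartesian cells.** A path $(\phi_1,\dotsc,\phi_n)$ of unary cells $\phi_i\colon\underline J_i\Rightarrow K_i$, $K_i\colon C_{i-1}\nrightarrow C_i$, with successive vertical sources/targets $f_0,\dotsc,f_n$, is weakly cocartesian if every cell $\psi$ with horizontal source $\underline J_1\frown\dotsb\frown\underline J_n$, vertical source $h\circ f_0$ and vertical target $k\circ f_n$ factors uniquely as $\psi'\circ(\phi_1,\dotsc,\phi_n)$ with $\psi'$ having horizontal source $(K_1,\dotsc,K_n)$, vertical source $h$ and target $k$. It is cocartesian if moreover (a) the restrictions $J'(\mathrm{id},f_0)$ and $J''(f_n,\mathrm{id})$ exist for all $J'\colon A'\nrightarrow C_0$ and $J''\colon C_n\nrightarrow A''$, and (b) for all paths $(J'_1,\dotsc,J'_p)$ ending at $C_0$ and $(J''_1,\dotsc,J''_q)$ starting at $C_n$, $p,q\ge0$, the path $(\mathrm{id}_{J'_1},\dotsc,\mathrm{id}_{J'_{p-1}},\mathrm{cart},\phi_1,\dotsc,\phi_n,\mathrm{cart},\mathrm{id}_{J''_2},\dotsc,\mathrm{id}_{J''_q})$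 is weakly cocartesian, with $\mathrm{cart}\colon J'_p(\mathrm{id},f_0)\Rightarrow J'_p$ and $\mathrm{cart}\colon J''_1(f_n,\mathrm{id})\Rightarrow J''_1$ the cartesian cells (the left, resp. right, part being omitted if $p=0$, resp. $q=0$). A single cell is cocartesian if it is so as a path of length $1$. **Tabulations.** A tabulation of $J\colon A\nrightarrow B$ is an object $\langle J\rangle$ with a unary cell $\pi\colon(\langle J\rangle)\Rightarrow J$, with vertical source $\pi_A\colon\langle J\rangle\to A$ and target $\pi_B\colon\langle J\rangle\to B$, such that: (1) every unary cell $\phi\colon(X)\Rightarrow J$, with vertical source $\phi_A$ and target $\phi_B$, equals $\pi\circ\phi'$ for a unique vertical morphism $\phi'\colon X\to\langle J\rangle$; (2) given unary cells $\phi\colon(X)\Rightarrow J$ and $\psi\colon(Y)\Rightarrow J$, with corresponding $\phi'$ and $\psi'$, a path $\underline H$ from $X$ to $Y$ and nullary cells $\xi_A\colon\underline H\Rightarrow A$ (vertical source $\phi_A$, target $\psi_A$) and $\xi_B\colon\underline H\Rightarrow B$ (vertical source $\phi_B$, target $\psi_B$) with $\xi_A\odot\psi=\phi\odot\xi_B$, there is a unique nullary cell $\xi'\colon\underline H\Rightarrow\langle J\rangle$, with vertical source $\phi'$ and target $\psi'$, such that $\pi_A\circ\xi'=\xi_A$ and $\pi_B\circ\xi'=\xi_B$. **Kan extensions.** Let $\eta\colon(J_1,\dotsc,J_n)\Rightarrow M$ be a nullary cell with vertical source $d\colon A_0\to M$ and target $l\colon A_n\to M$. It defines $l$ as the left Kan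 extension of $d$ along $(J_1,\dotsc,J_n)$ if for every path $\underline H=(H_1,\dotsc,H_m)$, $m\ge0$, from $A_n$ to $B_m$ and every $k\colon B_m\to M$, each nullary cell $\phi\colon(J_1,\dotsc,J_n)\frown\underline H\Rightarrow M$ with vertical source $d$ and target $k$ factors uniquely as $\phi=\eta\odot\phi'$ with $\phi'\colon\underline H\Rightarrow M$ having vertical source $l$ and target $k$; it defines $l$ as the weak left Kan extension if this holds for $m=0$. If $n\ge1$, it defines $l$ as the pointwise (weak) left Kan extension if, for every $f\colon B\to A_n$ such that $J_n(\mathrm{id},f)$ exists, the composite $\eta\circ(\mathrm{id}_{J_1},\dotsc,\mathrm{id}_{J_{n-1}},\mathrm{cart})$, with $\mathrm{cart}\colon J_n(\mathrm{id},f)\Rightarrow J_n$, defines $l\circ f$ as the (weak) left Kan extension of $d$ along $(J_1,\dotsc,J_{n-1},J_n(\mathrm{id},f))$. *)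

(* Defs.v *)
From Corelib Require Import ssreflect ssrbool.

Set Implicit Arguments.
Unset Strict Implicit.
Unset Printing Implicit Defensive.

Declare Scope avdc_scope.
Delimit Scope avdc_scope with avdc.
Open Scope avdc_scope.

Inductive path (O : Type) (H : O -> O -> Type) : O -> O -> Type :=
| pnil A : path H A A
| pcons A B C : H A B -> path H B C -> path H A C.
Arguments pnil {O H A}.
Arguments pcons {O H A B C} _ _.

Fixpoint papp (O : Type) (H : O -> O -> Type) (A B C : O) (p : path H A B) :
    path H B C -> path H A C :=
  match p in path _ A B return path H B C -> path H A C with
  | pnil => fun q => q
  | pcons J p => fun q => pcons J (papp p q)
  end.
Notation "p ++ q" := (papp p q) : avdc_scope.
Notation "[: J ]" := (pcons J pnil) (at level 0, format "[: J ]") : avdc_scope.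

Lemma papp_assoc (O : Type) (H : O -> O -> Type) (A B C D : O)
    (p : path H A B) (q : path H B C) (r : path H C D) :
  p ++ (q ++ r) = (p ++ q) ++ r.
Proof.
induction p as [|A0 A1 A2 J p IH]; simpl; [reflexivity|].
now rewrite IH.
Defined.

(* Paths of length at most 1: the possible horizontal targets of a cell. *)
Inductive spath (O : Type) (H : O -> O -> Type) : O -> O -> Type :=
| snil A : spath H A A
| sone A B : H A B -> spath H A B.
Arguments snil {O H} A.
Arguments sone {O H A B} _.

Definition path_of_spath (O : Type) (H : O -> O -> Type) (A B : O)
    (K : spath H A B) : path H A B :=
  match K with snil A => pnil | sone K => [: K] end.
Coercion path_of_spath : spath >-> path.

(* The vertical category, the horizontal morphisms and the cells, without the
   operations on cells.  A term of [cell J K f g] is a cell J => K with vertical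
   source f and vertical target g. *)
Record cell_graph := CellGraph {
  obj : Type;
  ver : obj -> obj -> Type;
  vid : forall A, ver A A;
  vcomp : forall A B C, ver B C -> ver A B -> ver A C;
  vcomp_id_l : forall A B (f : ver A B), vcomp (vid B) f = f;
  vcomp_id_r : forall A B (f : ver A B), vcomp f (vid A) = f;
  vcomp_assoc : forall A B C D (h : ver C D) (g : ver B C) (f : ver A B),
    vcomp h (vcomp g f) = vcomp (vcomp h g) f;
  hor : obj -> obj -> Type;
  cell : forall A B C D : obj,
    path hor A B -> spath hor C D -> ver A C -> ver B D -> Type
}.
Arguments ver {c} _ _.
Arguments vid {c} A.
Arguments vcomp {c A B C} _ _.
Arguments hor {c} _ _.
Arguments cell {c A B C D} _ _ _ _.
Notation "g ∘ f" := (vcomp g f) (at level 40, left associativity) : avdc_scope.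
Notation hpath := (path hor).
Notation hspath := (spath hor).

(* Equality of cells.  The boundaries are indices, so that cells whose boundaries
   are equal but not convertible (e.g. because of associativity of ∘ or ++) can
   be compared; equality of the boundaries is part of the assertion. *)
Inductive cell_eq (G : cell_graph) (A B C D : obj G) (J : hpath A B)
    (K : hspath C D) (f : ver A C) (g : ver B D) (phi : cell J K f g) :
  forall (A' B' C' D' : obj G) (J' : hpath A' B') (K' : hspath C' D')
         (f' : ver A' C') (g' : ver B' D'), cell J' K' f' g' -> Prop :=
| cell_eq_refl : cell_eq phi phi.
Notation "phi ≡ psi" := (cell_eq phi psi) (at level 70) : avdc_scope.

(* Nonempty sequences (phi_1, ..., phi_n) in which the vertical target of each
   cell is the vertical source of the next.  The indices are the concatenations
   of the horizontal sources and of the horizontal targets, the vertical source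
   of phi_1 and the vertical target of phi_n. *)
Inductive cells (G : cell_graph) : forall A B C D : obj G,
    hpath A B -> hpath C D -> ver A C -> ver B D -> Type :=
| cells_one (A B C D : obj G) (J : hpath A B) (K : hspath C D)
    (f : ver A C) (g : ver B D) : cell J K f g -> cells J K f g
| cells_cons (A B B' C D D' : obj G) (J : hpath A B) (J' : hpath B B')
    (K : hspath C D) (K' : hpath D D') (f : ver A C) (g : ver B D)
    (h : ver B' D') :
    cell J K f g -> cells J' K' g h -> cells (J ++ J') (K ++ K') f h.
Arguments cells_one {G A B C D J K f g} _.
Arguments cells_cons {G A B B' C D D' J J' K K' f g h} _ _.

Definition cells_cast (G : cell_graph) (A B C D : obj G) (J J' : hpath A B)
    (K K' : hpath C D) (f : ver A C) (g : ver B D)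
    (eJ : J = J') (eK : K = K') (Phi : cells J K f g) : cells J' K' f g :=
  match eJ in _ = J', eK in _ = K' return cells J' K' f g with
  | eq_refl, eq_refl => Phi
  end.

Fixpoint cells_app (G : cell_graph) (A B B' C D D' : obj G) (J : hpath A B)
    (J' : hpath B B') (K : hpath C D) (K' : hpath D D') (f : ver A C)
    (g : ver B D) (h : ver B' D') (Phi : cells J K f g) :
    cells J' K' g h -> cells (J ++ J') (K ++ K') f h :=
  match Phi in @cells _ A B C D J K f g
    return forall (J' : hpath B B') (K' : hpath D D'),
      cells J' K' g h -> cells (J ++ J') (K ++ K') f h with
  | cells_one phi => fun _ _ Psi => cells_cons phi Psi
  | cells_cons phi Phi => fun _ _ Psi =>
      cells_cast (papp_assoc _ _ _) (papp_assoc _ _ _)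
        (cells_cons phi (cells_app Phi Psi))
  end J' K'.

Fixpoint unary_cells (G : cell_graph) (A B C D : obj G) (J : hpath A B)
    (K : hpath C D) (f : ver A C) (g : ver B D) (Phi : cells J K f g) : Prop :=
  match Phi with
  | @cells_one _ _ _ _ _ _ K _ _ _ => exists K', K = sone K'
  | @cells_cons _ _ _ _ _ _ _ _ _ K _ _ _ _ _ Phi =>
      (exists K', K = sone K') /\ unary_cells Phi
  end.

Record cell_ops := CellOps {
  graph :> cell_graph;
  comp : forall (A B C D E F : obj graph) (J : hpath A B) (K : hpath C D)
      (L : hspath E F) (f : ver A C) (g : ver B D) (h : ver C E) (k : ver D F),
    cell K L h k -> cells J K f g -> cell J L (h ∘ f) (k ∘ g);
  hid : forall (A B : obj graph) (J : hor A B),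
    cell [: J] (sone J) (vid A) (vid B);
  cid : forall (A C : obj graph) (f : ver A C), cell pnil (snil C) f f
}.
Arguments comp {c A B C D E F J K L f g h k} _ _.
Arguments hid {c A B} J.
Arguments cid {c A C} f.

Definition sid (K : cell_ops) (C D : obj K) (L : hspath C D) :
    cell L L (vid C) (vid D) :=
  match L with snil C => cid (vid C) | sone L => hid L end.
Arguments sid {K C D} L.

(* (id_{J_0}, ..., id_{J_n}), for the path J = J_0, p = (J_1, ..., J_n). *)
Fixpoint ids (K : cell_ops) (A B C : obj K) (J : hor A B) (p : hpath B C) :
    cells (pcons J p) (pcons J p) (vid A) (vid C) :=
  match p in path _ B C
    return forall J : hor A B, cells (pcons J p) (pcons J p) (vid A) (vid C) with
  | pnil => fun J => cells_one (hid J)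
  | pcons J' p => fun J => cells_cons (hid J) (ids J' p)
  end J.

(* (id_{H_1}, ..., id_{H_n}, phi_1, ..., phi_m); H may be empty. *)
Fixpoint ids_then (K : cell_ops) (X A B D : obj K) (H : hpath X A) :
    forall (J : hpath A B) (L : hpath A D) (g : ver B D),
    cells J L (vid A) g -> cells (H ++ J) (H ++ L) (vid X) g :=
  match H in path _ X A
    return forall (J : hpath A B) (L : hpath A D) (g : ver B D),
      cells J L (vid A) g -> cells (H ++ J) (H ++ L) (vid X) g with
  | pnil => fun _ _ _ Phi => Phi
  | pcons J' H => fun _ _ _ Phi => cells_cons (hid J') (ids_then H Phi)
  end.

(* (phi, id_{H_1}, ..., id_{H_n}); H may be empty. *)
Definition then_ids (K : cell_ops) (A B C E : obj K) (J : hor A B)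
    (L : hor C B) (f : ver A C) (phi : cell [: J] (sone L) f (vid B))
    (H : hpath B E) : cells (pcons J H) (pcons L H) f (vid E) :=
  match H in path _ B E
    return forall (J : hor A B) (L : hor C B),
      cell [: J] (sone L) f (vid B) ->
      cells (pcons J H) (pcons L H) f (vid E) with
  | pnil => fun _ _ phi => cells_one phi
  | pcons H0 H => fun _ _ phi => cells_cons phi (ids H0 H)
  end J L phi.

(* [layers Psi Phi Theta]: Phi is a concatenation of sequences Phi_1, ..., Phi_n,
   Psi = (psi_1, ..., psi_n) and Theta = (psi_1 ∘ Phi_1, ..., psi_n ∘ Phi_n). *)
Inductive layers (X : cell_ops) : forall (A B C D E F : obj X)
    (J : hpath A B) (K : hpath C D) (L : hpath E F)
    (f : ver A C) (g : ver B D) (h : ver C E) (k : ver D F),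
    cells K L h k -> cells J K f g -> cells J L (h ∘ f) (k ∘ g) -> Prop :=
| layers_one (A B C D E F : obj X)
    (J : hpath A B) (K : hpath C D) (L : hspath E F)
    (f : ver A C) (g : ver B D) (h : ver C E) (k : ver D F)
    (psi : cell K L h k) (Phi : cells J K f g) :
    layers (cells_one psi) Phi (cells_one (comp psi Phi))
| layers_cons (A B B' C D D' E F F' : obj X)
    (J : hpath A B) (K : hpath C D) (L : hspath E F)
    (J' : hpath B B') (K' : hpath D D') (L' : hpath F F')
    (f : ver A C) (g : ver B D) (g' : ver B' D')
    (h : ver C E) (k : ver D F) (k' : ver D' F')
    (psi : cell K L h k) (Phi : cells J K f g)
    (Psi' : cells K' L' k k') (Phi' : cells J' K' g g')
    (Theta' : cells J' L' (k ∘ g) (k' ∘ g')) :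
    layers Psi' Phi' Theta' ->
    layers (cells_cons psi Psi') (cells_app Phi Phi')
      (cells_cons (comp psi Phi) Theta').

Record avdc := AVDC {
  ops :> cell_ops;
  comp_assoc : forall (A B C D E F P Q : obj ops)
      (J : hpath A B) (K : hpath C D) (L : hpath E F) (M : hspath P Q)
      (f : ver A C) (g : ver B D) (h : ver C E) (k : ver D F)
      (u : ver E P) (v : ver F Q)
      (chi : cell L M u v) (Psi : cells K L h k) (Phi : cells J K f g)
      (Theta : cells J L (h ∘ f) (k ∘ g)),
    layers Psi Phi Theta -> comp chi Theta ≡ comp (comp chi Psi) Phi;
  comp_cid_cid : forall (A B C : obj ops) (h : ver B C) (f : ver A B),
    comp (cid h) (cells_one (cid f)) = cid (h ∘ f);
  comp_sid_l : forall (A B C D : obj ops) (J : hpath A B) (K : hspath C D)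
      (f : ver A C) (g : ver B D) (phi : cell J K f g),
    comp (sid K) (cells_one phi) ≡ phi;
  comp_cid_r : forall (A C D : obj ops) (K : hspath C D)
      (f : ver A C) (g : ver A D) (phi : cell pnil K f g),
    comp phi (cells_one (cid (vid A))) ≡ phi;
  comp_ids_r : forall (A A' B C D : obj ops) (J : hor A A') (J' : hpath A' B)
      (K : hspath C D) (f : ver A C) (g : ver B D)
      (phi : cell (pcons J J') K f g),
    comp phi (ids J J') ≡ phi;
  (* Vertical identity cells may be omitted, whether they occur at the beginning,
     in the middle or at the end of a sequence.  In the last case the horizontal
     sources K ++ pnil and K are not convertible, so that the same cell psi
     appears with two types. *)
  comp_cid_first : forall (A B C D E F : obj ops)
      (J : hpath A B) (K : hpath C D) (L : hspath E F)
      (f : ver A C) (g : ver B D) (h : ver C E) (k : ver D F)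
      (psi : cell K L h k) (Phi : cells J K f g),
    comp (J := J) (K := K) psi (cells_cons (cid f) Phi) = comp psi Phi;
  comp_cid_mid : forall (A B B' C D D' E F : obj ops)
      (J : hpath A B) (J' : hpath B B') (K : hpath C D) (K' : hpath D D')
      (L : hspath E F)
      (f : ver A C) (g : ver B D) (g' : ver B' D') (h : ver C E) (k : ver D' F)
      (psi : cell (K ++ K') L h k)
      (Phi : cells J K f g) (Phi' : cells J' K' g g'),
    comp (J := J ++ J') (K := K ++ K') psi
      (cells_app Phi (cells_cons (cid g) Phi')) =
    comp psi (cells_app Phi Phi');
  comp_cid_last : forall (A B C D E F : obj ops)
      (J : hpath A B) (K : hpath C D) (L : hspath E F)
      (f : ver A C) (g : ver B D) (h : ver C E) (k : ver D F)
      (psi : cell K L h k) (psi' : cell (K ++ pnil) L h k)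
      (Phi : cells J K f g),
    psi' ≡ psi ->
    comp (K := K ++ pnil) psi' (cells_app Phi (cells_one (cid g))) ≡
    comp psi Phi
}.

Notation "h ∘v phi" := (comp (cid h) (cells_one phi))
  (at level 40, left associativity) : avdc_scope.
Notation "psi ∘c f" := (comp psi (cells_one (cid f)))
  (at level 40, left associativity) : avdc_scope.
(* The index P is the concatenation of the horizontal targets of phi and psi;
   it is given explicitly since this concatenation is only defined as a path. *)
Notation "phi ⊙[ P ] psi" := (comp (sid P) (cells_cons phi (cells_one psi)))
  (at level 40, left associativity) : avdc_scope.

Section Notions.
Context {X : avdc}.

Definition cartesian (A B C D : obj X) (J : hspath A B) (K : hspath C D)
    (f : ver A C) (g : ver B D) (psi : cell J K f g) : Prop :=
  forall (A' B' : obj X) (H : hpath A' B') (h : ver A' A) (k : ver B' B)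
      (chi : cell H K (f ∘ h) (g ∘ k)),
    exists! phi : cell H J h k, chi = comp psi (cells_one phi).

(* The horizontal morphism J, with the cell psi, is the restriction K(f,g). *)
Definition is_restriction (A B C D : obj X) (K : hspath C D) (f : ver A C)
    (g : ver B D) (J : hor A B) (psi : cell [: J] K f g) : Prop :=
  cartesian (J := sone J) psi.

Definition has_restriction (A B C D : obj X) (K : hspath C D) (f : ver A C)
    (g : ver B D) : Prop :=
  exists (J : hor A B) (psi : cell [: J] K f g), is_restriction psi.

Definition weakly_cocartesian (A B C D : obj X) (J : hpath A B)
    (K : hpath C D) (f : ver A C) (g : ver B D) (Phi : cells J K f g) : Prop :=
  unary_cells Phi /\
  forall (E F : obj X) (L : hspath E F) (h : ver C E) (k : ver D F)
      (psi : cell J L (h ∘ f) (k ∘ g)),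
    exists! psi' : cell K L h k, psi = comp psi' Phi.

(* [extend_right Phi Psi]: Psi is Phi, or Phi followed by
   (cart, id_{J_2}, ..., id_{J_q}) with cart : J_1(g, id) => J_1 cartesian. *)
Inductive extend_right (A B C D : obj X) (J : hpath A B) (K : hpath C D)
    (f : ver A C) (g : ver B D) (Phi : cells J K f g) :
    forall (B' D' : obj X) (J' : hpath A B') (K' : hpath C D') (g' : ver B' D'),
    cells J' K' f g' -> Prop :=
| extend_right_none : extend_right Phi Phi
| extend_right_cart (E E' : obj X) (J1 : hor D E) (R : hor B E)
    (cart : cell [: R] (sone J1) g (vid E)) (H : hpath E E') :
    is_restriction cart ->
    extend_right Phi (cells_app Phi (then_ids cart H)).

(* [extend_left Phi Psi]: Psi is Phi, or Phi preceded by
   (id_{J_1}, ..., id_{J_{p-1}}, cart) with cart : J_p(id, f) => J_p cartesian. *)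
Inductive extend_left (A B C D : obj X) (J : hpath A B) (K : hpath C D)
    (f : ver A C) (g : ver B D) (Phi : cells J K f g) :
    forall (A' C' : obj X) (J' : hpath A' B) (K' : hpath C' D) (f' : ver A' C'),
    cells J' K' f' g -> Prop :=
| extend_left_none : extend_left Phi Phi
| extend_left_cart (E E' : obj X) (Jp : hor E C) (R : hor E A)
    (cart : cell [: R] (sone Jp) (vid E) f) (H : hpath E' E) :
    is_restriction cart ->
    extend_left Phi (ids_then H (cells_cons cart Phi)).

Definition cocartesian_path (A B C D : obj X) (J : hpath A B) (K : hpath C D)
    (f : ver A C) (g : ver B D) (Phi : cells J K f g) : Prop :=
  [/\ weakly_cocartesian Phi,
      forall (E : obj X) (J' : hor E C), has_restriction (sone J') (vid E) f,
      forall (E : obj X) (J' : hor D E), has_restriction (sone J') g (vid E)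
    & forall (A' B' C' D' : obj X) (Jr : hpath A B') (Kr : hpath C D')
          (gr : ver B' D') (Phir : cells Jr Kr f gr)
          (Jl : hpath A' B') (Kl : hpath C' D') (fl : ver A' C')
          (Phil : cells Jl Kl fl gr),
        extend_right Phi Phir -> extend_left Phir Phil ->
        weakly_cocartesian Phil].

Definition cocartesian (A B C D : obj X) (J : hpath A B) (K : hspath C D)
    (f : ver A C) (g : ver B D) (phi : cell J K f g) : Prop :=
  cocartesian_path (cells_one phi).

Definition is_tabulation (A B : obj X) (J : hor A B) (T : obj X)
    (piA : ver T A) (piB : ver T B) (pi : cell pnil (sone J) piA piB) : Prop :=
  (forall (Y : obj X) (phiA : ver Y A) (phiB : ver Y B)
      (phi : cell pnil (sone J) phiA phiB),
    exists! phi' : ver Y T, phi ≡ pi ∘c phi') /\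
  (forall (Y Z : obj X) (phiA : ver Y A) (phiB : ver Y B)
      (psiA : ver Z A) (psiB : ver Z B)
      (phi : cell pnil (sone J) phiA phiB) (psi : cell pnil (sone J) psiA psiB)
      (phi' : ver Y T) (psi' : ver Z T),
    phi ≡ pi ∘c phi' -> psi ≡ pi ∘c psi' ->
    forall (H : hpath Y Z) (xiA : cell H (snil A) phiA psiA)
        (xiB : cell H (snil B) phiB psiB),
      xiA ⊙[sone J] psi ≡ phi ⊙[sone J] xiB ->
      exists! xi' : cell H (snil T) phi' psi',
        piA ∘v xi' ≡ xiA /\ piB ∘v xi' ≡ xiB).

Definition has_cocartesian_tabulations : Prop :=
  forall (A B : obj X) (J : hor A B),
    exists (T : obj X) (piA : ver T A) (piB : ver T B)
        (pi : cell pnil (sone J) piA piB),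
      is_tabulation pi /\ cocartesian pi.

Definition factors_uniquely_along (A B M E : obj X) (J : hpath A B)
    (d : ver A M) (l : ver B M) (eta : cell J (snil M) d l) (H : hpath B E) :
    Prop :=
  forall (k : ver E M) (phi : cell (J ++ H) (snil M) d k),
    exists! phi' : cell H (snil M) l k, phi ≡ eta ⊙[snil M] phi'.

Definition left_kan (A B M : obj X) (J : hpath A B) (d : ver A M) (l : ver B M)
    (eta : cell J (snil M) d l) : Prop :=
  forall (E : obj X) (H : hpath B E), factors_uniquely_along eta H.

Definition weak_left_kan (A B M : obj X) (J : hpath A B) (d : ver A M)
    (l : ver B M) (eta : cell J (snil M) d l) : Prop :=
  factors_uniquely_along eta pnil.

(* The composite with (id, ..., id, cart) has vertical source d ∘ id instead of d;
   these morphisms are equal. *)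
Definition pointwise_left_kan (A A' B M : obj X) (J : hpath A A')
    (Jn : hor A' B) (d : ver A M) (l : ver B M)
    (eta : cell (J ++ [: Jn]) (snil M) d l) : Prop :=
  forall (E : obj X) (f : ver E B) (R : hor A' E)
      (cart : cell [: R] (sone Jn) (vid A') f),
    is_restriction cart ->
    left_kan (comp eta (ids_then J (cells_one cart))).

Definition pointwise_weak_left_kan (A A' B M : obj X) (J : hpath A A')
    (Jn : hor A' B) (d : ver A M) (l : ver B M)
    (eta : cell (J ++ [: Jn]) (snil M) d l) : Prop :=
  forall (E : obj X) (f : ver E B) (R : hor A' E)
      (cart : cell [: R] (sone Jn) (vid A') f),
    is_restriction cart ->
    weak_left_kan (comp eta (ids_then J (cells_one cart))).

End Notions.
Arguments has_cocartesian_tabulations X : clear implicits.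

(* Main.v *)
From Corelib Require Import ssreflect ssrbool.
From Stdlib Require Import Program.Equality.
Require Import Defs.

(** Let [eta] be a pointwise weak left Kan extension and [H = (H_1, ..., H_m)] a
    path along which unique factorisations through [eta] are sought.  Induct on
    [m]; the case [m = 0] is the weak universal property.  Otherwise let [pi]
    be the cocartesian tabulation of [H_1], with legs [pi_A] and [pi_B].
    Precomposing with the weakly cocartesian paths
    [(id, ..., id, cart, pi, cart, id, ..., id)] and [(pi, cart, id, ..., id)]
    replaces [eta] by its restriction along [pi_A], which is again a pointwise
    weak left Kan extension, and [H] by the shorter path
    [(H_2(pi_B, id), H_3, ..., H_m)]. *)

Set Implicit Arguments.
Unset Strict Implicit.
Unset Printing Implicit Defensive.

Section CellEquality.
Context {G : cell_graph}.

(** This rests on uniqueness of identity proofs for the boundary indices, supplied by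
    [dependent destruction]. *)
Lemma cell_eq_eq (A B C D : obj G) (J : hpath A B) (K : hspath C D)
    (f : ver A C) (g : ver B D) (phi psi : cell J K f g) :
  phi ≡ psi -> phi = psi.
Proof. by move=> e; dependent destruction e. Qed.

Lemma cell_eq_sym (A B C D A' B' C' D' : obj G) (J : hpath A B)
    (K : hspath C D) (f : ver A C) (g : ver B D) (J' : hpath A' B')
    (K' : hspath C' D') (f' : ver A' C') (g' : ver B' D')
    (phi : cell J K f g) (psi : cell J' K' f' g') :
  phi ≡ psi -> psi ≡ phi.
Proof. by case. Qed.

Lemma cell_eq_trans (A B C D A' B' C' D' A'' B'' C'' D'' : obj G)
    (J : hpath A B) (K : hspath C D) (f : ver A C) (g : ver B D)
    (J' : hpath A' B') (K' : hspath C' D') (f' : ver A' C') (g' : ver B' D')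
    (J'' : hpath A'' B'') (K'' : hspath C'' D'') (f'' : ver A'' C'')
    (g'' : ver B'' D'')
    (phi : cell J K f g) (psi : cell J' K' f' g') (chi : cell J'' K'' f'' g'') :
  phi ≡ psi -> psi ≡ chi -> phi ≡ chi.
Proof. by move=> e; case. Qed.

(** The unit and associativity laws of [∘] are only propositional, so a cell may need transport
    before a universal property applies to it. *)
Definition cell_vcast (A B C D : obj G) (J : hpath A B) (K : hspath C D)
    (f f' : ver A C) (g g' : ver B D) (ef : f = f') (eg : g = g')
    (phi : cell J K f g) : cell J K f' g' :=
  match ef in _ = f', eg in _ = g' return cell J K f' g' with
  | eq_refl, eq_refl => phi
  end.

Definition cells_vcast (A B C D : obj G) (J : hpath A B) (K : hpath C D)
    (f f' : ver A C) (g g' : ver B D) (ef : f = f') (eg : g = g')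
    (Phi : cells J K f g) : cells J K f' g' :=
  match ef in _ = f', eg in _ = g' return cells J K f' g' with
  | eq_refl, eq_refl => Phi
  end.

Lemma cell_vcast_eq (A B C D : obj G) (J : hpath A B) (K : hspath C D)
    (f f' : ver A C) (g g' : ver B D) (ef : f = f') (eg : g = g')
    (phi : cell J K f g) : cell_vcast ef eg phi ≡ phi.
Proof. by destruct ef, eg. Qed.

End CellEquality.

Section CellOps.
Context {X : cell_ops}.

Lemma comp_congr_l (A B C D E F : obj X) (J : hpath A B) (K : hpath C D)
    (L : hspath E F) (f : ver A C) (g : ver B D) (h h' : ver C E)
    (k k' : ver D F) (Phi : cells J K f g)
    (psi : cell K L h k) (psi' : cell K L h' k') :
  h = h' -> k = k' -> psi ≡ psi' -> comp psi Phi ≡ comp psi' Phi.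
Proof. by move=> eh ek; subst=> /cell_eq_eq ->. Qed.

Lemma comp_cells_vcast (A B C D E F : obj X) (J : hpath A B) (K : hpath C D)
    (L : hspath E F) (f f' : ver A C) (g g' : ver B D) (h : ver C E)
    (k : ver D F) (ef : f = f') (eg : g = g') (Phi : cells J K f g)
    (psi : cell K L h k) :
  comp psi (cells_vcast ef eg Phi) ≡ comp psi Phi.
Proof. by destruct ef, eg. Qed.

(** Rebrackets [(id, ..., id, cart)] followed by [Phi] into the form produced by [extend_left]. *)
Lemma cells_app_ids_then (Y A B C D E : obj X) (H : hpath Y A)
    (J : hpath A B) (L : hpath A D) (g : ver B D) (Phi : cells J L (vid A) g)
    (J' : hpath B C) (L' : hpath D E) (h : ver C E) (Psi : cells J' L' g h) :
  exists eJ eL, cells_app (ids_then H Phi) Psi =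
    cells_cast eJ eL (ids_then H (cells_app Phi Psi)).
Proof.
elim: H J L Phi => [Z|Z Z' A0 J0 H IH] J L Phi /=.
  by exists eq_refl, eq_refl.
have [eJ [eL ->]] := IH J L Phi.
exists (f_equal (pcons J0) eJ), (f_equal (pcons J0) eL).
by case: _ / eJ; case: _ / eL.
Qed.

End CellOps.

Section Factorisation.
Context {X : avdc}.

Lemma cartesian_vcast (A B C D : obj X) (J : hspath A B) (K : hspath C D)
    (f f' : ver A C) (g g' : ver B D) (ef : f = f') (eg : g = g')
    (psi : cell J K f g) :
  cartesian psi -> cartesian (cell_vcast ef eg psi).
Proof. by destruct ef, eg. Qed.

Lemma cartesian_comp (A B C D E F : obj X) (I : hspath A B) (J : hspath C D)
    (K : hspath E F) (f : ver C E) (g : ver D F) (f' : ver A C) (g' : ver B D)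
    (psi : cell J K f g) (psi' : cell I J f' g') :
  cartesian psi -> cartesian psi' -> cartesian (comp psi (cells_one psi')).
Proof.
move=> cpsi cpsi' Y Z H h k chi.
have assoc phi : comp psi (cells_one (comp psi' (cells_one phi))) ≡
    comp (comp psi (cells_one psi')) (cells_one phi)
  by move=> *; apply: comp_assoc; apply: layers_one.
pose chi' := cell_vcast (eq_sym (vcomp_assoc f f' h))
  (eq_sym (vcomp_assoc g g' k)) chi.
have echi : chi' ≡ chi := cell_vcast_eq _ _ _.
have [phi1 [e1 u1]] := cpsi _ _ _ _ _ chi'.
have [phi2 [e2 u2]] := cpsi' _ _ _ _ _ phi1.
exists phi2; split.
  apply: cell_eq_eq; apply: cell_eq_trans (assoc _ _ _ _ _ _).
  by rewrite -e2 -e1; apply: cell_eq_sym.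
move=> phi e; apply: u2; apply: u1; apply: cell_eq_eq.
apply: cell_eq_trans echi _; rewrite e; exact: cell_eq_sym (assoc _ _ _ _ _ _).
Qed.

Lemma weakly_cocartesian_cast (A B C D : obj X) (J J' : hpath A B)
    (K K' : hpath C D) (eJ : J = J') (eK : K = K') (f : ver A C) (g : ver B D)
    (Phi : cells J K f g) :
  weakly_cocartesian Phi -> weakly_cocartesian (cells_cast eJ eK Phi).
Proof. by destruct eJ, eK. Qed.

(** The uniqueness half of weak cocartesianness. Propositionally equal boundaries are allowed
    because [eta ⊙[snil M] phi'] has vertical source [vid M ∘ d] rather than [d]. *)
Lemma weakly_cocartesian_inj (A B C D E F : obj X) (J : hpath A B)
    (K : hpath C D) (L : hspath E F) (f : ver A C) (g : ver B D)
    (h h' : ver C E) (k k' : ver D F) (Phi : cells J K f g)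
    (psi : cell K L h k) (psi' : cell K L h' k') :
  weakly_cocartesian Phi -> h = h' -> k = k' ->
  comp psi Phi ≡ comp psi' Phi -> psi ≡ psi'.
Proof.
move=> [_ wPhi] eh ek; subst=> /cell_eq_eq e.
have [chi [_ u]] := wPhi _ _ _ _ _ (comp psi Phi).
by rewrite -(u _ (eq_refl _)) -(u _ e).
Qed.

Lemma weak_left_kan_congr (A B M : obj X) (J : hpath A B) (d d' : ver A M)
    (l l' : ver B M) (eta : cell J (snil M) d l) (eta' : cell J (snil M) d' l') :
  d = d' -> l = l' -> eta ≡ eta' -> weak_left_kan eta -> weak_left_kan eta'.
Proof. by move=> ed el; subst=> /cell_eq_eq ->. Qed.

(** Precomposition with [Phi] is a bijection on the candidate factors, and with
    [(id, ..., id, cart, Phi)] on the cells to be factored. These bijections turn factorisation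
    through the restricted [eta] into factorisation through [eta]. *)
Lemma factors_uniquely_descent (A A' B M T E E' : obj X) (J : hpath A A')
    (Jn : hor A' B) (d : ver A M) (l : ver B M)
    (eta : cell (J ++ [: Jn]) (snil M) d l) (R : hor A' T) (f : ver T B)
    (cart : cell [: R] (sone Jn) (vid A') f) (H' : hpath T E') (H : hpath B E)
    (g : ver E' E) (Phi : cells H' H f g) :
  weakly_cocartesian Phi ->
  weakly_cocartesian (ids_then J (cells_cons cart Phi)) ->
  factors_uniquely_along (comp eta (ids_then J (cells_one cart))) H' ->
  factors_uniquely_along eta H.
Proof.
move=> wPhi wids fact k phi.
pose P := cells_app (ids_then J (cells_one cart)) Phi.
have wP : weakly_cocartesian P.
  have [eJ [eK eP]] := cells_app_ids_then J (cells_one cart) Phi.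
  by rewrite /P eP; apply: weakly_cocartesian_cast.
(* The two bijections commute with pasting on [eta] and on its restriction, by associativity. *)
have key (phi' : cell H (snil M) l k) :
    comp (eta ⊙[snil M] phi') P ≡
    comp eta (ids_then J (cells_one cart)) ⊙[snil M] comp phi' Phi.
  have lay := layers_cons eta (ids_then J (cells_one cart)) (layers_one phi' Phi).
  exact/cell_eq_sym/(comp_assoc _ lay).
have [phi1 [e1 u1]] := fact _ (comp phi P).
have [_ /(_ _ _ _ _ _ phi1) [phi' [e' u']]] := wPhi.
exists phi'; split.
  apply: (weakly_cocartesian_inj wP); rewrite ?vcomp_id_l //.
  apply: cell_eq_trans e1 _; rewrite e'; exact: cell_eq_sym.
move=> phi'' e; apply: u'; apply: u1.
apply: cell_eq_trans (key _).
by apply: comp_congr_l => //; rewrite vcomp_id_l.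
Qed.

(** Composing layerwise gives [(id ∘ id, ..., id ∘ id, psi ∘ phi)]; the cast turns the leftmost
    vertical source [id ∘ id] into [id]. *)
Lemma layers_ids_then (A A' B C D : obj X) (J : hpath A A') (I : hor A' B)
    (K : hor A' C) (L : hor A' D) (f : ver C D) (g : ver B C)
    (psi : cell [: K] (sone L) (vid A') f)
    (phi : cell [: I] (sone K) (vid A') g)
    (chi : cell [: I] (sone L) (vid A') (f ∘ g)) :
  comp psi (cells_one phi) ≡ chi ->
  exists Theta,
    layers (ids_then J (cells_one psi)) (ids_then J (cells_one phi)) Theta /\
    Theta = cells_vcast (eq_sym (vcomp_id_l (vid A))) eq_refl
              (ids_then J (cells_one chi)).
Proof.
elim: J I K L psi phi chi => [Z|Z Z' A0 J0 J IH] I K L psi phi chi e /=.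
  exists (cells_one (comp psi (cells_one phi))); split.
    exact: (layers_one psi (cells_one phi)).
  move: (comp _ _) e; case: _ / (eq_sym _) => a e.
  by rewrite (cell_eq_eq e).
have [Theta [lay eTheta]] := IH _ _ _ _ _ _ e.
exists (cells_cons (comp (hid J0) (cells_one (hid J0))) Theta); split.
  exact: (layers_cons (hid J0) (cells_one (hid J0)) lay).
rewrite {lay}eTheta.
(* Once the composite is generalised, both occurrences of [id ∘ id] can be eliminated. *)
move: (comp _ _) (comp_sid_l (hid J0)).
case: _ / (eq_sym (vcomp_id_l (vid Z'))).
case: _ / (eq_sym (vcomp_id_l (vid Z))) => a ea.
by rewrite (cell_eq_eq ea).
Qed.

(** Cartesian cells compose, so restricting along [f] and then [g] is restricting along [f ∘ g],
    where the hypothesis on [eta] applies. *)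
Lemma pointwise_weak_restriction (A A' B M T : obj X) (J : hpath A A')
    (Jn : hor A' B) (d : ver A M) (l : ver B M)
    (eta : cell (J ++ [: Jn]) (snil M) d l) (f : ver T B) (R : hor A' T)
    (cart : cell [: R] (sone Jn) (vid A') f) :
  is_restriction cart -> pointwise_weak_left_kan eta ->
  pointwise_weak_left_kan (comp eta (ids_then J (cells_one cart))).
Proof.
move=> rcart weta E g S cart' rcart'.
pose cart2 := cell_vcast (vcomp_id_l (vid A')) (eq_refl (f ∘ g))
  (comp cart (cells_one cart')).
have rcart2 : is_restriction cart2.
  exact/(cartesian_vcast (J := sone S))/(cartesian_comp rcart rcart').
have e2 : comp cart (cells_one cart') ≡ cart2.
  exact/cell_eq_sym/cell_vcast_eq.
have [Theta [lay eTheta]] := layers_ids_then J e2.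
have e : comp eta (ids_then J (cells_one cart2)) ≡
    comp (comp eta (ids_then J (cells_one cart))) (ids_then J (cells_one cart')).
  apply: cell_eq_trans (comp_assoc _ lay); rewrite eTheta.
  exact/cell_eq_sym/comp_cells_vcast.
move: (weta _ _ _ _ rcart2).
apply: weak_left_kan_congr e.
  by rewrite -vcomp_assoc vcomp_id_l.
by rewrite vcomp_assoc.
Qed.

Lemma pointwise_weak_factors (A A' B B' E M : obj X) (J : hpath A A')
    (Jn : hor A' B) (d : ver A M) (l : ver B M)
    (eta : cell (J ++ [: Jn]) (snil M) d l) (H1 : hor B B')
    (H : hpath B' E) :
  has_cocartesian_tabulations X -> pointwise_weak_left_kan eta ->
  factors_uniquely_along eta (pcons H1 H).
Proof.
move=> tab.
(* [eta] and its boundary vary, since the induction hypothesis is applied to the restriction of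
   [eta] along [piA]. *)
elim: H B Jn d l eta H1 => [C|C C' E' H2 H IH] B Jn d l eta H1 weta;
  have [T [piA [piB [pi [_ [wpi resl resr ext]]]]]] := tab _ _ H1;
  have [R [cart rcart]] := resl _ Jn.
(* [pi] has empty horizontal source, so the path left after descent is empty and the weak property
   at [piA] suffices. *)
- apply: (factors_uniquely_descent (cart := cart) wpi).
    apply: ext; first exact: extend_right_none.
    exact: extend_left_cart.
  exact: weta.
- have [R2 [cart2 rcart2]] := resr _ H2.
  have rext := extend_right_cart (cells_one pi) H rcart2.
  apply: (factors_uniquely_descent (cart := cart)
            (Phi := cells_app (cells_one pi) (then_ids cart2 H))).
  + exact: ext rext (extend_left_none _).
  + exact: ext rext (extend_left_cart _ _ rcart).
  + exact/IH/pointwise_weak_restriction.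
Qed.

End Factorisation.

Theorem theorem4p34 (X : avdc) :
  has_cocartesian_tabulations X ->
  forall (A A' B M : obj X) (J : hpath A A') (Jn : hor A' B)
      (d : ver A M) (l : ver B M) (eta : cell (J ++ [: Jn]) (snil M) d l),
    pointwise_weak_left_kan eta -> pointwise_left_kan eta.
Proof.
move=> tab A A' B M J Jn d l eta weta E f R cart rcart F H.
(* The empty path is the weak property itself; for a nonempty one, the restricted cell is first
   shown to be pointwise weak again. *)
case: H f R cart rcart => [?|? ? ? H1 H] f R cart rcart; first exact: weta.
exact/pointwise_weak_factors/(pointwise_weak_restriction rcart).
Qed.
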